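(* Let $X$ be a nonempty set and let $F$ be a multifunction on $X$ such that $\mathrm{Dom}(F)=X$ and $x_0\notin F(x_0)$ for some $x_0\in X$. (1) Suppose that, for some $M,N\in\mathbb{N}$, $\#P_F(X,x_0;2)>MN^3$ and $\#P_F(X,x;1)\le N$ for all $x\neq x_0$ in $X$. Then $F$ has no iterative roots of order $n\ge 2$ in $\mathcal{F}_M(X)$. If, in addition, $F\in\mathcal{F}_M(X)$ and $\mathrm{Im}(F)=X$, then $F$ has no iterative roots of order $n\ge 2$ at all (i.e., none in $\mathcal{F}(X)$). (2) Suppose that $P_F(X,x_0;2)$ is infinite and $P_F(X,x;1)$ is finite for all $x\neq x_0$ in $X$. Then $F$ has no iterative roots of order $n\ge 2$ in $\mathcal{F}_{\mathsf f}(X)$. If, in addition, $F\in\mathcal{F}_{\mathsf f}(X)$ and $\mathrm{Im}(F)=X$, then $F$ has no iterative roots of order $n\ge 2$ at all. (3) Suppose that $P_F(X,x_0;2)$ is uncountable and $P_F(X,x;1)$ is countable for all $x\neq x_0$ in $X$. Then $F$ has no iterative roots of order $n\ge 2$ in $\mathcal{F}_{\mathsf c}(X)$. If, in addition, $F\in\mathcal{F}_{\mathsf c}(X)$ and $\mathrm{Im}(F)=X$, then $F$ has no iterative roots of order $n\ge 2$ at all.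
   Context: $\mathbb{N}$ is the set of positive integers, and $\#A$ is the cardinality of $A$; countable means finite or countably infinite. A multifunction on a nonempty set $X$ is a function $F:X\to 2^X$ (empty values allowed); $\mathcal{F}(X)$ is the set of all multifunctions on $X$. For $A\subseteq X$, $F(A)=\bigcup_{x\in A}F(x)$. $\mathrm{Dom}(F)=\{x\in X:\#F(x)\ge 1\}$ and $\mathrm{Im}(F)=F(X)$. Iterates: $F^0(x)=\{x\}$ and $F^n(x)=\bigcup_{y\in F^{n-1}(x)}F(y)$. An iterative root of $F$ of order $n$ is a $G\in\mathcal{F}(X)$ with $G^n(x)=F(x)$ for all $x\in X$. The graph of $F$ is the directed graph with vertex set $X$ and edge set $\{(x,y):y\in F(x)\}$. For $k\in\mathbb{N}$, a $k$-path from $x$ to $y$ is a sequence of $k$ edges $((x,u_1),(u_1,u_2),\ldots,(u_{k-1},y))$ (not necessarily distinct) of this graph (for $k=1$, a single edge $(x,y)$). $P_F(X,y;k)$ is the set of all $k$-paths in the graph of $F$ beginning at some point of $X$ and ending at $y$; $P_F(x,X;k)$ is the set of all $k$-paths beginning at $x$ and ending at some point of $X$. $\mathcal{F}_M(X)=\{F\in\mathcal{F}(X):\#P_F(x,X;1)\le M \text{ for all } x\in X\}$ for $M\in\mathbb{N}$; $\mathcal{F}_{\mathsf f}(X)=\{F\in\mathcal{F}(X):P_F(x,X;1)\text{ is finite for all }x\in X\}$; $\mathcal{F}_{\mathsf c}(X)=\{F\in\mathcal{F}(X):P_F(x,X;1)\text{ is countable for all }x\in X\}$. *)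

(* Defs.v *)
From mathcomp Require Import all_boot.
From mathcomp Require Import mathcomp_extra boolp classical_sets functions cardinality.

Set Implicit Arguments.
Unset Strict Implicit.
Unset Printing Implicit Defensive.

Local Open Scope classical_set_scope.
Local Open Scope card_scope.

Section Cardinals.
Variables T U : Type.

Definition card_lt (A : set T) (B : set U) : Prop :=
  A #<= B /\ ~ (B #<= A).

End Cardinals.

Notation "A '#<' B" := (card_lt A B)
  (at level 79, format "A  '#<'  B") : card_scope.

Section Multifunctions.
Variable X : Type.

Definition multifun := X -> set X.

Implicit Types (F G : multifun) (A : set X).

Definition mimage F A : set X := \bigcup_(x in A) F x.

Definition Dom F : set X := [set x | F x !=set0].

Definition Im F : set X := mimage F [set: X].

Fixpoint miter F (n : nat) (x : X) : set X :=
  if n is m.+1 then mimage F (miter F m x) else [set x].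

Definition iterative_root F (n : nat) G : Prop :=
  forall x, miter G n x = F x.

Definition graph F : set (X * X) := [set e | F e.1 e.2].

(* The list of edges s is a directed walk from x to y; the empty list is
   accepted only when x = y. *)
Fixpoint is_path F (x : X) (s : seq (X * X)) (y : X) : Prop :=
  if s is e :: s' then [/\ graph F e, e.1 = x & is_path F e.2 s' y]
  else x = y.

Definition paths_to F (y : X) (k : nat) : set (seq (X * X)) :=
  [set s | size s = k /\ exists x, is_path F x s y].

Definition paths_from F (x : X) (k : nat) : set (seq (X * X)) :=
  [set s | size s = k /\ exists y, is_path F x s y].

Definition mf_bounded (M : nat) : set multifun :=
  [set F | forall x, paths_from F x 1 #<= `I_M].

Definition mf_finite : set multifun :=
  [set F | forall x, finite_set (paths_from F x 1)].

Definition mf_countable : set multifun :=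
  [set F | forall x, countable (paths_from F x 1)].

Definition no_roots_in (C : set multifun) F : Prop :=
  forall n, (2 <= n)%N -> ~ exists2 G, C G & iterative_root F n G.

End Multifunctions.

(* Main.v *)
Require Import Defs.
From mathcomp Require Import all_boot.
From mathcomp Require Import mathcomp_extra boolp classical_sets functions cardinality.

Local Open Scope classical_set_scope.
Local Open Scope card_scope.

(** Let [G] be a root of [F] of order [n >= 2], and fix [q] in [G x0]; then
    [q <> x0], since a loop of [G] at [x0] would give a loop of [F] at [x0].
    Given a 2-path [x -> y -> x0] of [F], choose a vertex [u] of a walk of [G]
    such that [x] leads to [u] in [n - 1] steps and [y] is in [G u], and let [w]
    be the successor of [y] on a walk of [G] of length [n] from [y] to [x0].
    Walking on from [x0] to [q] shows that [q] is in [F w].  The last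
    vertex [z] before [x0] can be taken to depend on [w] alone; [z <> x0], and
    [z] is in [F u].  So [w] is an [F]-predecessor of [q], [u] one of
    [z], [y] is in [G u], and [x] is an [F]-predecessor of [y]:
    when these choices are bounded by [N], [N], [M], [N], there are at most
    [M * N ^ 3] 2-paths, and likewise in the finite and countable cases. *)

Lemma card_le_IP (T : Type) (A : set T) (n : nat) :
  A #<= `I_n <->
  exists f : T -> nat, (forall x, A x -> (f x < n)%N) /\
    forall x y, A x -> A y -> f x = f y -> x = y.
Proof.
split=> [/pcard_leP[f]|[f [fn finj]]].
  exists f; split=> [x Ax|x y Ax Ay]; first exact: (@funS _ _ _ _ f x Ax).
  by apply: inj; rewrite inE.
have finjA : set_inj A f by move=> x y /[!inE]; exact: finj.
have /card_eqPle[_ Af] := inj_card_eq finjA.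
apply: card_le_trans Af (subset_card_le _) => _ [x Ax <-]; exact: fn.
Qed.

(** An element [x] is coded in base [b]: the quotient is the number of a chosen index [h x] whose
    set contains [x], the remainder is the number of [x] within that set. *)
Lemma card_le_bigcup_I (I T : Type) (D : set I) (B : I -> set T) (a b : nat) :
  D #<= `I_a -> (forall i, D i -> B i #<= `I_b) ->
  \bigcup_(i in D) B i #<= `I_(a * b).
Proof.
move=> /card_le_IP[f [fa finj]] Bb.
have /choice[g gP] : forall i, exists g : T -> nat, D i ->
    (forall x, B i x -> (g x < b)%N) /\
    forall x y, B i x -> B i y -> g x = g y -> x = y.
  move=> i; have [Di|nDi] := pselect (D i); last by exists (fun=> 0).
  by have /card_le_IP[g gP] := Bb _ Di; exists g.
have [[i0 _]|noD] := pselect (exists i, D i); last first.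
  apply/card_le_IP; exists (fun=> 0).
  by split=> [x|x y] [i Di]; case: noD; exists i.
have /choice[h hP] : forall x, exists i, (\bigcup_(i in D) B i) x ->
    D i /\ B i x.
  move=> x; have [[i Di Bx]|nx] := pselect ((\bigcup_(i in D) B i) x).
    by exists i.
  by exists i0 => /nx.
apply/card_le_IP; exists (fun x => f (h x) * b + g (h x) x)%N.
split=> [x /hP[Dx Bx]|x y /hP[Dx Bx] /hP[Dy By] e].
  have [/(_ _ Bx) gb _] := gP _ Dx.
  apply: (@leq_trans ((f (h x)).+1 * b)); last by rewrite leq_mul2r fa ?orbT.
  by rewrite mulSn addnC ltn_add2r.
have [gxb ginj] := gP _ Dx; have [gyb _] := gP _ Dy.
have b0 : (0 < b)%N by apply: leq_ltn_trans (gxb _ Bx).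
have eh : h x = h y.
  apply: finj => //; have := congr1 (divn^~ b) e.
  by rewrite !divnMDl // !divn_small ?gxb ?gyb // !addn0.
by apply: ginj => //; [rewrite eh|move: e; rewrite eh => /addnI].
Qed.

Section Multifunctions.
Variable X : Type.
Implicit Types (F G : multifun X) (x y : X).

Lemma miter_front G m x y :
  miter G m.+1 x y <-> exists2 w, G x w & miter G m w y.
Proof.
elim: m y => [|m IH] y.
  by split=> [[_ -> ?]|[w ? ->]]; [exists y|exists x].
split=> [[v /IH[w xw wv] vy]|[w xw [v wv vy]]].
  by exists w => //; exists v.
by exists v => //; apply/IH; exists w.
Qed.

Lemma miter_fixed G m x : G x x -> miter G m x x.
Proof. by move=> xx; elim: m => // m IH; exists x. Qed.

(** Carries size bounds from 1-paths ending at [y] over to the set of predecessors of [y]. *)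
Lemma preimage_pointE F y :
  [set x | F x y] = (fun s => (head (y, y) s).1) @` paths_to F y 1.
Proof.
apply/seteqP; split=> [x Fxy|_ [s [s1 [x xy]] <-]].
  by exists [:: (x, y)] => //; split=> //; exists x.
case: s s1 xy => [|[a b] []]//= _ [Fab _ <-]; exact: Fab.
Qed.

Lemma image_pointE G x :
  G x = (fun s => (head (x, x) s).2) @` paths_from G x 1.
Proof.
apply/seteqP; split=> [y Gxy|_ [s [s1 [y xy]] <-]].
  by exists [:: (x, y)] => //; split=> //; exists y.
case: s s1 xy => [|[a b] []]//= _ [Gab <- _]; exact: Gab.
Qed.

Lemma paths_from1E G x :
  paths_from G x 1 = (fun y => [:: (x, y)]) @` G x.
Proof.
apply/seteqP; split=> [s [s1 [y xy]]|_ [y Gxy <-]].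
  by case: s s1 xy => [|[a b] []]//= _ [Gab <- _]; exists b.
by split=> //; exists y.
Qed.

Lemma root_total F n G :
  Dom F = [set: X] -> (0 < n)%N -> iterative_root F n G ->
  forall x, exists y, G x y.
Proof.
case: n => // n hDom _ hG x.
have [y] : Dom F x by rewrite hDom.
by rewrite -hG => /miter_front[w]; exists w.
Qed.

Lemma root_paths2_cover F n G x0 :
  Dom F = [set: X] -> ~ F x0 x0 -> iterative_root F n.+2 G ->
  exists q : X, exists z : X -> X, [/\ q <> x0, forall w, z w <> x0 &
    paths_to F x0 2 `<=` \bigcup_(w in [set w | F w q])
      \bigcup_(u in [set u | F u (z w)]) \bigcup_(y in G u `\ x0)
        ((fun s => rcons s (y, x0)) @` paths_to F y 1)].
Proof.
move=> hDom hx0 hG.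
have Gx0 y : G y x0 -> y <> x0.
  move=> Gyx0 eyx0; rewrite eyx0 in Gyx0; apply: hx0; rewrite -hG.
  exact: miter_fixed.
have [q Gq] := root_total _ _ _ hDom (ltn0Sn _) hG x0.
have qx0 : q <> x0 by move=> e; apply: (Gx0 x0); rewrite -?{2}e.
have /choice[z zP] : forall w, exists z, z <> x0 /\
    (miter G n.+1 w x0 -> miter G n w z /\ G z x0).
  move=> w; have [[z wz zx0]|nw] := pselect (miter G n.+1 w x0).
    by exists z; split=> //; exact: Gx0.
  (* Default for a [w] from which no walk of length [n.+1] reaches [x0]; it keeps [z w <> x0] for
     every [w]. *)
  by exists q; split=> // /nw.
exists q, z; split=> // [w|]; first by have [] := zP w.
move=> s [s2 [x' xx0]].
case: s s2 xx0 => [|[x y] [|[y' x1] []]]//= _ [Fxy _ [Fyx0 ey ex]].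
move: Fxy Fyx0; rewrite /graph /= ey ex => Fxy Fyx0.
have yx0 : y <> x0 by move=> e; apply: hx0; rewrite -{1}e.
have [u xu uy] : miter G n.+2 x y by rewrite hG.
have /miter_front[w yw wx0] : miter G n.+2 y x0 by rewrite hG.
have [_ /(_ wx0)[wz _]] := zP w.
exists w; first by rewrite /= -hG; exists x0.
exists u.
  (* The walk goes from [u] to [y] to [w], then in [n] steps to [z w]: [n.+2] edges in all. *)
  rewrite /= -hG; apply/miter_front; exists y => //.
  by apply/miter_front; exists w.
exists y => //; exists [:: (x, y)] => //.
by split=> //; exists x.
Qed.

(** Surjectivity of [F] gives every point a [G]-predecessor, so one can walk back [n] steps from [u]
    to some [v]; a step of [G] out of [u] then ends a walk of length [n.+1] from [v]. *)
Lemma root_image_sub F n G :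
  Im F = [set: X] -> iterative_root F n.+1 G ->
  forall u, exists v, G u `<=` F v.
Proof.
move=> hIm hG u.
have Gpred y : exists x, G x y.
  have [x _] : Im F y by rewrite hIm.
  by rewrite -hG => -[w _ wy]; exists w.
have [v vu] : exists v, miter G n v u.
  elim: n u {hG} => [|n IH] u; first by exists u.
  by have [w wu] := Gpred u; have [v vw] := IH w; exists v, w.
by exists v => y uy; rewrite -hG; exists u.
Qed.

(** [small k A] stands for "[A] has at most [k] elements", for "[A] is finite"
    or for "[A] is countable"; the last two ignore [k]. *)
Lemma no_roots_small (small : nat -> forall T : Type, set T -> Prop)
    (small_le : forall k (T U : Type) (A : set T) (B : set U),
      A #<= B -> small k U B -> small k T A)
    (small_bigcup : forall a b (I T : Type) (D : set I) (B : I -> set T),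
      small a I D -> (forall i, D i -> small b T (B i)) ->
      small (a * b)%N T (\bigcup_(i in D) B i))
    F x0 (M N : nat) :
  Dom F = [set: X] -> ~ F x0 x0 ->
  ~ small (M * N ^ 3)%N _ (paths_to F x0 2) ->
  (forall x, x <> x0 -> small N _ (paths_to F x 1)) ->
  let C := [set G : multifun X | forall x, small M _ (paths_from G x 1)] in
  no_roots_in C F /\
  (C F -> Im F = [set: X] -> no_roots_in [set: multifun X] F).
Proof.
move=> hDom hx0 nsmall sN C.
have noC : no_roots_in C F.
  move=> [|[|n]] // _ [G CG hG]; apply: nsmall.
  have [q [z [qx0 zx0 cover]]] := root_paths2_cover _ _ _ _ hDom hx0 hG.
  have small_pre y : y <> x0 -> small N _ [set x | F x y].
    by move=> /sN; apply: (small_le); rewrite preimage_pointE card_image_le.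
  apply: (small_le) (subset_card_le cover) _.
  (* The factors are put in the order of the nested unions: over [w], [u], [y], and then the 1-paths
     into [y]. *)
  have -> : (M * N ^ 3 = N * (N * (M * N)))%N.
    by rewrite !expnS expn0 muln1 mulnCA; congr muln; rewrite mulnCA.
  apply: (small_bigcup) => [|w _]; first exact: small_pre.
  apply: (small_bigcup) => [|u _]; first exact: small_pre.
  apply: (small_bigcup) => [|y [_ yx0]].
    apply: (small_le) (CG u).
    apply: (@card_le_trans _ _ _ (G u)); first by apply: subset_card_le => y [].
    by rewrite {1}image_pointE card_image_le.
  by apply: (small_le) (sN y yx0); exact: card_image_le.
(* Any root [G] lies in [C], since each [G u] is contained in some [F v], which is small. *)
split=> // CF hIm n n2 [G _ hG]; apply: (noC n n2); exists G => // u.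
case: n n2 hG => // n _ hG.
have [v Guv] := root_image_sub _ _ _ hIm hG u.
apply: (small_le) (CF v); rewrite paths_from1E.
apply: card_le_trans (card_image_le _ _) _.
apply: card_le_trans (subset_card_le Guv) _.
by rewrite {1}image_pointE card_image_le.
Qed.

End Multifunctions.

Theorem theorem1 (X : Type) (F : multifun X) (x0 : X)
    (hDom : Dom F = [set: X]) (hx0 : ~ F x0 x0) :
  [/\ forall M N : nat, (0 < M)%N -> (0 < N)%N ->
        `I_(M * N ^ 3) #< paths_to F x0 2 ->
        (forall x, x <> x0 -> paths_to F x 1 #<= `I_N) ->
        no_roots_in (@mf_bounded X M) F /\
        (mf_bounded M F -> Im F = [set: X] -> no_roots_in [set: multifun X] F),
      infinite_set (paths_to F x0 2) ->
        (forall x, x <> x0 -> finite_set (paths_to F x 1)) ->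
        no_roots_in (@mf_finite X) F /\
        (mf_finite F -> Im F = [set: X] -> no_roots_in [set: multifun X] F)
    & ~ countable (paths_to F x0 2) ->
        (forall x, x <> x0 -> countable (paths_to F x 1)) ->
        no_roots_in (@mf_countable X) F /\
        (mf_countable F -> Im F = [set: X] -> no_roots_in [set: multifun X] F)].
Proof.
split=> [M N _ _ [_ nsmall] sN|nfin sfin|ncount scount].
- apply: (no_roots_small _ (fun k T A => A #<= `I_k)) nsmall sN => //.
    by move=> k T U A B; exact: card_le_trans.
  by move=> a b I T D B; exact: card_le_bigcup_I.
(* The two zeros are dummy values of [M] and [N], which finiteness ignores. *)
- apply: (no_roots_small _ (fun _ T A => finite_set A) _ _ _ _ 0 0) nfin sfin => //.
    by move=> _ T U A B; exact: card_le_finite.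
  by move=> _ _ I T D B; exact: bigcup_finite.
- apply: (no_roots_small _ (fun _ T A => countable A) _ _ _ _ 0 0) ncount scount => //.
    by move=> _ T U A B; exact: card_le_trans.
  by move=> _ _ I T D B; exact: bigcup_countable.
Qed.
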